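(* For integers $n\ge 1$ and $d\ge 1$ let $$ \mathcal{Z}_{n,d}=\left\{\sum_{i=1}^n\lambda_i X_i\colon \lambda_1,\ldots,\lambda_n\in[0,1]\right\} $$ be the Gaussian zonotope, i.e. the Minkowski sum of the segments $[0,X_1],\ldots,[0,X_n]$, where $X_1,X_2,\ldots$ are independent random vectors with standard Gaussian distribution on $\mathbb{R}^d$. Then $$ \mathbb{E} f_k(\mathcal{Z}_{n,d}) < \mathbb{E} f_k(\mathcal{Z}_{n+1,d}) $$ for all integers $n\geq 1$, $d\geq 2$, and $0\leq k<\min(n,d)$.
   Context: For a polytope $P$ of dimension $\dim(P)$ (the dimension of its affine hull) and $k\in\{0,\ldots,\dim(P)\}$, $f_k(P)$ is the number of $k$-dimensional faces of $P$; in particular $f_{\dim(P)}(P)=1$. Moreover $f_k(P)=0$ for $k>\dim(P)$ and for $k<0$. *)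

(* Defs.v *)
From HB Require Import structures.
From mathcomp Require Import all_boot all_order all_algebra finmap.
From mathcomp Require Import all_classical all_reals all_analysis.
Import Order.TTheory GRing.Theory Num.Theory.
Import numFieldNormedType.Exports.

Set Implicit Arguments.
Unset Strict Implicit.
Unset Printing Implicit Defensive.

Local Open Scope classical_set_scope.
Local Open Scope ring_scope.

Section Polytopes.
Variables (R : realType) (d : nat).
Implicit Types (P F A : set 'rV[R]_d).

Definition dotprod (u x : 'rV[R]_d) : R := \sum_(j < d) u 0 j * x 0 j.

Definition affine_hull A : set 'rV[R]_d :=
  [set x | exists (m : nat) (a : 'I_m -> R) (y : 'I_m -> 'rV[R]_d),
    [/\ forall i, A (y i), \sum_(i < m) a i = 1
      & x = \sum_(i < m) a i *: y i]].

(* The empty set has no dimension: [has_dim set0 k] is false for every [k]. *)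
Definition has_dim A (k : nat) : Prop :=
  exists (x0 : 'rV[R]_d) (W : {vspace 'rV[R]_d}),
    \dim W = k /\ affine_hull A = [set x0 + w | w in [set` W]].

(* [u = 0] is allowed: with [c = 0] it makes [P] a face of itself, and with
   [c = 1] it makes the empty set a face. *)
Definition is_face P F : Prop :=
  exists (u : 'rV[R]_d) (c : R),
    (forall x, P x -> dotprod u x <= c) /\
    F = P `&` [set x | dotprod u x = c].

(* [fset_set] returns the empty set on infinite sets; a polytope has finitely
   many faces. *)
Definition f_ (k : nat) P : nat :=
  #|` fset_set [set F | is_face P F /\ has_dim F k] |.

Definition zonotope (n : nat) (v : 'I_n -> 'rV[R]_d) : set 'rV[R]_d :=
  [set x | exists2 l : 'I_n -> R, (forall i, 0 <= l i <= 1)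
                                & x = \sum_(i < n) l i *: v i].

End Polytopes.

(* R^d with its Borel sigma-algebra; convertible to ['rV[R]_d]. *)
Definition borel_rV (R : realType) (d : nat) :=
  g_sigma_algebraType (@open 'rV[R]_d).

Section GaussianVectors.
Context {disp : measure_display} {Omega : measurableType disp} {R : realType}.
Variable P : probability Omega R.
Local Open Scope ereal_scope.

Definition independent_RVs (I : choiceType) (disp' : measure_display)
    (T : measurableType disp') (X : I -> {RV P >-> T}) : Prop :=
  forall (J : {fset I}) (B : I -> set T),
    (forall i, i \in J -> measurable (B i)) ->
    P (\bigcap_(i in [set` J]) (X i @^-1` B i)) =
    \prod_(i <- J) P (X i @^-1` B i).

(* The law of [X] is the d-fold product of N(0,1), i.e. the coordinates of [X]
   are independent standard normal variables.  The second parameter of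
   [normal_prob] is the standard deviation. *)
Definition standard_gaussian (d : nat) (X : {RV P >-> borel_rV R d}) : Prop :=
  forall A : 'I_d -> set R, (forall j, measurable (A j)) ->
    distribution P X [set x : 'rV[R]_d | forall j, A j (x ord0 j)] =
    \prod_(j < d) normal_prob 0%R 1%R (A j).

Definition gaussian_zonotope (d : nat) (X : nat -> {RV P >-> borel_rV R d})
    (n : nat) (w : Omega) : set 'rV[R]_d :=
  zonotope (fun i : 'I_n => X i w : 'rV[R]_d).

End GaussianVectors.

(* Main.v *)
Require Import Defs.
From HB Require Import structures.
From mathcomp Require Import all_boot all_order all_algebra finmap.
From mathcomp Require Import all_classical all_reals all_analysis.
From mathcomp Require Import measurable_realfun.
Import Order.TTheory GRing.Theory Num.Theory.
Import numFieldNormedType.Exports.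
Local Open Scope ring_scope.

(** The inequality holds sample by sample, almost surely: when the vectors are
in general position, adding one more of them to the zonotope creates at least
one more [k]-face.

The faces of a zonotope correspond to the covectors of its generators.  The
face on which a functional [u] is maximal consists of the combinations whose
[i]-th coefficient is 1, 0 or free according as [u . v_i] is positive, negative
or zero, and conversely it determines these signs ([face_of_is_face],
[is_face_covector], [face_of_inj]).  Its direction is spanned by the [v_i] with
[u . v_i = 0], so in general position and for [k < d] the [k]-faces are counted
by the sign patterns with exactly [k] zeros ([f_covectors]).

Such sign patterns can be composed: a small multiple of [w] added to [u] fills
the zeros of [u] with the signs of [w] and keeps all other signs
([covector_comp]).  Consequently every [k]-zero pattern on [n] generators
extends, with a nonzero last sign, to a [k]-zero pattern on [n + 1] generators.
These extensions can be chosen so as to avoid some [k]-zero pattern on [n + 1]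
generators: if [k > 0], one that vanishes at the last generator; if [k = 0], one
of the two patterns obtained by moving in opposite directions away from a
functional that vanishes at the last generator only ([covectors_surplus]).  So
the count strictly increases ([ltn_card_covectors]).

General position means that any [d] of the vectors, with distinct indices among
all the natural numbers, have a nonzero determinant; this covers the case of
fewer than [d] generators as well, because the infinite sequence provides
vectors to complete them.  That the determinant is almost surely nonzero is
shown by letting the vectors replace the rows of the identity matrix one at a
time.  The determinant is then an affine function [A Y + B] of one Gaussian
coordinate [Y], where [A] is the preceding determinant and [A], [B] depend only
on other coordinates.  As these are independent of [Y] and [Y] has no atom,
Fubini's theorem makes the event [A <> 0, A Y + B = 0] null
([affine_root_null], [det_partial_matrix_null]).

Face numbers are bounded by [3 ^ n] in general position, so the gap of 1 on an
event of probability one survives integration ([expectation_lt_full_measure]).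
*)
Set Implicit Arguments.
Unset Strict Implicit.
Unset Printing Implicit Defensive.

(** * Bilinearity of the dot product *)
Section DotProduct.
Context {R : realType} {d : nat}.
Implicit Types (u w x y : 'rV[R]_d) (a : R).

Lemma dotprodDl u w x : dotprod (u + w) x = dotprod u x + dotprod w x.
Proof.
by rewrite -big_split /=; apply: eq_bigr => j _; rewrite mxE mulrDl.
Qed.

Lemma dotprodZl a u x : dotprod (a *: u) x = a * dotprod u x.
Proof. by rewrite mulr_sumr; apply: eq_bigr => j _; rewrite mxE mulrA. Qed.

Lemma dotprod0l x : dotprod 0 x = 0.
Proof. by rewrite -(scale0r 0) dotprodZl mul0r. Qed.

Lemma dotprodZr a u x : dotprod u (a *: x) = a * dotprod u x.
Proof. by rewrite mulr_sumr; apply: eq_bigr => j _; rewrite mxE mulrCA. Qed.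

Lemma dotprod_sumr u n (x : 'I_n -> 'rV[R]_d) :
  dotprod u (\sum_(i < n) x i) = \sum_(i < n) dotprod u (x i).
Proof.
rewrite exchange_big /=; apply: eq_bigr => j _.
by rewrite summxE mulr_sumr.
Qed.

Lemma dotprod_combination u n (l : 'I_n -> R) (v : 'I_n -> 'rV[R]_d) :
  dotprod u (\sum_(i < n) l i *: v i) = \sum_(i < n) l i * dotprod u (v i).
Proof. by rewrite dotprod_sumr; apply: eq_bigr => i _; rewrite dotprodZr. Qed.

End DotProduct.

(** * Faces of a zonotope and covectors of its generators *)
Section Covectors.
Context {R : realType} {d : nat}.
Implicit Types (u w x : 'rV[R]_d) (n : nat) (a l : R).

Definition sign_of a : option bool := if a == 0 then None else Some (0 < a).

Definition covector n (v : 'I_n -> 'rV[R]_d) u : {ffun 'I_n -> option bool} :=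
  [ffun i => sign_of (dotprod u (v i))].

Definition zeros n (s : {ffun 'I_n -> option bool}) : {set 'I_n} :=
  [set i | s i == None].

Definition fits (s : option bool) l : bool :=
  if s is Some b then l == b%:R else true.

(** For a realizable sign pattern [s], this is the face of the zonotope on which
a functional with these signs is maximal ([face_ofE]). *)
Definition face_of n (v : 'I_n -> 'rV[R]_d) (s : {ffun 'I_n -> option bool}) :
    set 'rV[R]_d :=
  [set x | exists2 l : 'I_n -> R, forall i, (0 <= l i <= 1) && fits (s i) (l i)
         & x = \sum_(i < n) l i *: v i]%classic.

(** The maximum of the functional [u] over the zonotope: the support function,
where each generator contributes its positive part. *)
Definition support n (v : 'I_n -> 'rV[R]_d) u : R :=
  \sum_(i < n) (0 < dotprod u (v i))%R%:R * dotprod u (v i).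

Lemma fits_leif l a : 0 <= l <= 1 ->
  l * a <= (0 < a)%R%:R * a ?= iff fits (sign_of a) l.
Proof.
rewrite /sign_of => /andP[l0 l1]; have [->|a0] := eqVneq a 0.
  by rewrite !mulr0 /=; apply/leif_refl.
split; last by rewrite /= (inj_eq (mulIf a0)).
have [ap|an] := ltP 0 a; first by rewrite ler_wpM2r// ltW.
by rewrite mul0r mulr_ge0_le0.
Qed.

(** The functional is maximized coordinatewise, so the equality case is decided
coordinate by coordinate.  It holds for every way to write the point as a
combination, which is what makes the signs readable from the face. *)
Lemma zonotope_leif n (v : 'I_n -> 'rV[R]_d) u (l : 'I_n -> R) :
  (forall i, 0 <= l i <= 1) ->
  dotprod u (\sum_(i < n) l i *: v i) <= support v u
    ?= iff [forall i, fits (covector v u i) (l i)].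
Proof.
move=> hl; rewrite dotprod_combination.
have := @leif_sum R _ xpredT (fun i => fits (covector v u i) (l i))
  (fun i => l i * dotprod u (v i)) _ _; apply => i _.
by rewrite ffunE; apply: fits_leif.
Qed.

(** Free coefficients are set to 0, which yields a base point of the face. *)
Definition vertex n (s : {ffun 'I_n -> option bool}) (i : 'I_n) : R :=
  (s i == Some true)%:R.

Lemma vertexP n (s : {ffun 'I_n -> option bool}) i :
  (0 <= vertex s i <= 1) && fits (s i) (vertex s i).
Proof.
by rewrite /vertex; case: (s i) => [[]|] /=; rewrite ?lexx ?ler01 ?eqxx.
Qed.

Lemma face_ofE n (v : 'I_n -> 'rV[R]_d) u :
  face_of v (covector v u) =
  (zonotope v `&` [set x | dotprod u x = support v u])%classic.
Proof.
apply/seteqP; split=> x /=.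
  move=> [l hl ->]; have hl' i : 0 <= l i <= 1 by case/andP: (hl i).
  split; first by exists l.
  by apply/eqP; rewrite (zonotope_leif v u hl'); apply/forallP => i; case/andP: (hl i).
move=> [[l hl ->] /eqP]; rewrite (zonotope_leif v u hl) => /forallP fl.
by exists l => // i; rewrite hl fl.
Qed.

Lemma face_of_is_face n (v : 'I_n -> 'rV[R]_d) u :
  is_face (zonotope v) (face_of v (covector v u)).
Proof.
exists u, (support v u); split; last exact: face_ofE.
by move=> x [l hl ->]; case: (zonotope_leif v u hl).
Qed.

(** A supporting hyperplane that meets the zonotope must sit at the height of the
maximum, so the nonempty faces are exactly the maximal sets of functionals. *)
Lemma is_face_covector n (v : 'I_n -> 'rV[R]_d) (F : set 'rV[R]_d) x :
  is_face (zonotope v) F -> F x -> exists u, F = face_of v (covector v u).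
Proof.
move=> [u [c [zc ->]]] [[l hl xE] /= xc]; exists u.
rewrite face_ofE; congr (_ `&` _)%classic.
suff -> : c = support v u by [].
have := zonotope_leif v u hl; rewrite -xE xc => -[cs _].
have : face_of v (covector v u) (\sum_(i < n) vertex (covector v u) i *: v i).
  by exists (vertex (covector v u)) => // i; exact: vertexP.
rewrite face_ofE => -[/zc yc /= ys].
by apply/eqP; rewrite eq_le cs -ys.
Qed.

(** On the larger face the [i]-th coefficient of any combination is forced to be
[b]; if the smaller face left it free or forced it to be the other endpoint,
it would contain a combination that violates this. *)
Lemma face_of_sub n (v : 'I_n -> 'rV[R]_d) u u' i b :
  (face_of v (covector v u') `<=` face_of v (covector v u))%classic ->
  covector v u i = Some b -> covector v u' i = Some b.
Proof.
move=> sub ui; apply/eqP/negPn/negP => u'i.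
pose l j := if j == i then (if covector v u' i is Some c then c%:R else (~~ b)%:R)
            else vertex (covector v u') j : R.
have hl j : (0 <= l j <= 1) && fits (covector v u' j) (l j).
  rewrite /l; case: eqVneq => [->|_]; last exact: vertexP.
  by case: (covector v u' i) => [[]|] /=; case: (b) => /=; rewrite ?eqxx ?lexx ?ler01.
have hl' j : 0 <= l j <= 1 by case/andP: (hl j).
have /sub : face_of v (covector v u') (\sum_j l j *: v j) by exists l.
rewrite face_ofE => -[_ /= /eqP].
rewrite (zonotope_leif v u hl') => /forallP /(_ i).
rewrite ui /l eqxx /=; case: (covector v u' i) u'i => [c|_].
  by rewrite eqr_nat; case: (b) (c) => -[].
by rewrite eqr_nat; case: (b).
Qed.

Lemma face_of_inj n (v : 'I_n -> 'rV[R]_d) u u' :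
  face_of v (covector v u) = face_of v (covector v u') ->
  covector v u = covector v u'.
Proof.
move=> e; apply/ffunP => i.
case e1: (covector v u i) => [b|]; case e2: (covector v u' i) => [c|] //.
- by have := @face_of_sub n v u u' i b; rewrite e e1 e2 => /(_ (fun=> id) erefl) ->.
- by have := @face_of_sub n v u u' i b; rewrite e e1 e2 => /(_ (fun=> id) erefl).
- by have := @face_of_sub n v u' u i c; rewrite e e1 e2 => /(_ (fun=> id) erefl).
Qed.

End Covectors.

(** * Dimension of faces *)
Section FaceDimension.
Context {R : realType} {d : nat}.
Implicit Types (u w x : 'rV[R]_d) (n k : nat).

Definition span_of n (v : 'I_n -> 'rV[R]_d) (I : {set 'I_n}) :
    {vspace 'rV[R]_d} := (\sum_(i in I) <[v i]>)%VS.

Lemma mem_span_of n (v : 'I_n -> 'rV[R]_d) (I : {set 'I_n}) (c : 'I_n -> R) :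
  (forall i, i \notin I -> c i = 0) -> \sum_(i < n) c i *: v i \in span_of v I.
Proof.
move=> c0; apply: memv_suml => i _.
have [iI|/c0->] := boolP (i \in I); last by rewrite scale0r mem0v.
by apply: memvZ; apply: (subvP (sumv_sup _ iI (subvv _))); exact: memv_line.
Qed.

Lemma span_ofP n (v : 'I_n -> 'rV[R]_d) (I : {set 'I_n}) x :
  x \in span_of v I -> exists2 c : 'I_n -> R,
    (forall i, i \notin I -> c i = 0) & x = \sum_(i < n) c i *: v i.
Proof.
move/memv_sumP => [y yv ->].
have /choice[c hc] : forall i, exists a, i \in I -> y i = a *: v i.
  move=> i; have [iI|_] := boolP (i \in I); last by exists 0.
  by have /vlineP[a ->] := yv _ iI; exists a.
exists (fun i => if i \in I then c i else 0).
  by move=> i /negbTE ->.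
rewrite big_mkcond /=; apply: eq_bigr => i _; case: ifP => [/hc //|_].
by rewrite scale0r.
Qed.

(** Two points of the face differ only in the free coefficients; conversely the
base point and its translates by the free generators already span. *)
Lemma affine_hull_face_of n (v : 'I_n -> 'rV[R]_d) s :
  affine_hull (face_of v s) =
  [set \sum_(i < n) vertex s i *: v i + w | w in [set` span_of v (zeros s)]]%classic.
Proof.
set p := \sum_(i < n) _.
apply/seteqP; split=> x /=.
  move=> [m [a [y [yF a1 ->]]]].
  exists (\sum_(j < m) a j *: (y j - p)); last first.
    under eq_bigr do rewrite scalerBr.
    by rewrite sumrB -scaler_suml a1 scale1r addrC subrK.
  apply: memv_suml => j _; apply: memvZ; have [l hl ->] := yF j.
  rewrite -sumrB; under eq_bigr do rewrite -scalerBl.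
  apply: mem_span_of => i; rewrite inE => si.
  have /andP[_] := hl i; have /andP[_] := vertexP (R := R) s i.
  by case: (s i) si => [b _ /eqP -> /eqP ->|//]; rewrite subrr.
(* Affine combination of the base point [p] and the points [p + v i]; entry 0
   carries the weight that makes the coefficients sum to 1. *)
move=> [w /span_ofP [c c0 ->] <-].
pose S := \sum_i c i.
exists n.+1, (fun j => if unlift ord0 j is Some i then c i else 1 - S).
exists (fun j => if unlift ord0 j is Some i then
   (if i \in zeros s then p + v i else p) else p).
have pF : face_of v s p by exists (vertex s) => // i; exact: vertexP.
split.
- move=> j; case: unlift => [i|//]; case: ifP => // si.
  exists (fun i' => if i' == i then 1 else vertex s i').
    move=> i'; case: eqVneq => [->|_]; last exact: vertexP.
    by move: si; rewrite inE => /eqP ->; rewrite ler01 lexx.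
  rewrite /p (bigD1 i) //= [RHS](bigD1 i) //= eqxx scale1r addrAC.
  congr (_ + _); last by apply: eq_bigr => i' /negbTE ->.
  by move: si; rewrite inE /vertex => /eqP ->; rewrite scale0r add0r.
- rewrite big_ord_recl /= unlift_none; under eq_bigr do rewrite /= liftK.
  by rewrite subrK.
- rewrite [RHS]big_ord_recl /= unlift_none.
  under [X in _ = _ + X]eq_bigr do rewrite /= liftK.
  rewrite scalerBl scale1r -addrA; congr (_ + _).
  rewrite /S scaler_suml -sumrN -big_split /=; apply: eq_bigr => i _.
  case: ifPn => [_|/c0 ->]; last by rewrite !scale0r oppr0 addr0.
  by rewrite scalerDr addKr.
Qed.

(** The linear space [W] of [has_dim] is determined by the affine hull, so the
dimension is well defined. *)
Lemma has_dim_face_of n (v : 'I_n -> 'rV[R]_d) s k :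
  has_dim (face_of v s) k <-> \dim (span_of v (zeros s)) = k.
Proof.
split; last first.
  exists (\sum_(i < n) vertex s i *: v i), (span_of v (zeros s)).
  by split=> //; exact: affine_hull_face_of.
rewrite /has_dim affine_hull_face_of => -[x0 [W [<-]]].
set p := \sum_(i < n) _; set U := span_of _ _ => e.
have [w0 w0W pE] : [set x0 + w | w in [set` W]]%classic p.
  by rewrite -e; exists 0; rewrite /= ?mem0v ?addr0.
suff -> : U = W by [].
apply/vspaceP => w; apply/idP/idP => wU.
  have [w1 w1W] : [set x0 + w | w in [set` W]]%classic (p + w) by rewrite -e; exists w.
  rewrite -pE -addrA => /addrI w1E.
  by rewrite -(addKr w0 w) -w1E addrC memvB.
have [w1 w1U] : [set p + w | w in [set` U]]%classic (x0 + (w0 + w)).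
  by rewrite e; exists (w0 + w) => //; exact: memvD.
by rewrite addrA pE => /addrI <-.
Qed.

(** General position in dual form: a generator lies outside the span of any fewer
than [d] other ones, witnessed by a functional.  Both the dimension count and
the construction of covectors use these functionals directly. *)
Definition separated n (v : 'I_n -> 'rV[R]_d) :=
  forall (I : {set 'I_n}) j, (#|I| < d)%N -> j \notin I ->
  exists2 w, (forall i, i \in I -> dotprod w (v i) = 0) & dotprod w (v j) = 1.

Lemma dim_span_of n (v : 'I_n -> 'rV[R]_d) (I : {set 'I_n}) :
  separated v -> (#|I| <= d)%N -> \dim (span_of v I) = #|I|.
Proof.
move=> sv Id.
have sep j : j \in I -> exists2 w,
    (forall i, i \in I -> i != j -> dotprod w (v i) = 0) & dotprod w (v j) = 1.
  move=> jI; have [||w w0 w1] := sv (I :\ j)%SET j.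
  - by move: Id; rewrite (cardsD1 j) jI.
  - by rewrite !inE eqxx.
  by exists w => // i iI ij; apply: w0; rewrite !inE ij.
have dI : directv (\sum_(i in I) <[v i]>)%VS.
  apply/directv_sum_independent => us usv us0 j jI.
  have [w w0 w1] := sep _ jI.
  have /vlineP[a ua] := usv _ jI.
  suff a0 : a = 0 by rewrite ua a0 scale0r.
  have : dotprod w (\sum_(i < n) (if i \in I then us i else 0)) = 0.
    by rewrite -big_mkcond us0 -(scale0r 0) dotprodZr mul0r.
  rewrite dotprod_sumr (bigD1 j) //= jI ua dotprodZr w1 mulr1 big1 ?addr0//.
  move=> i ij; case: ifPn => [iI|_]; last by rewrite -(scale0r 0) dotprodZr mul0r.
  by have /vlineP[b ->] := usv _ iI; rewrite dotprodZr w0 ?mulr0.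
rewrite /span_of (directvP dI) /= -sum1_card; apply: eq_bigr => j jI.
rewrite dim_vline; have [w _] := sep _ jI; have [->|//] := eqVneq (v j) 0.
by rewrite -(scale0r 0) dotprodZr mul0r => /eqP; rewrite eq_sym oner_eq0.
Qed.

(** When [I] has more than [d] elements, [d] of them already span a space of
dimension [d > k], so neither side holds. *)
Lemma dim_span_of_eq n (v : 'I_n -> 'rV[R]_d) (I : {set 'I_n}) k :
  separated v -> (k < d)%N -> (\dim (span_of v I) == k) = (#|I| == k).
Proof.
move=> sv kd; have [Id|dI] := leqP #|I| d; first by rewrite dim_span_of.
have /card_geqP[s [us ss sI]] := ltnW dI.
have : (\dim (span_of v [set i in s]%SET) <= \dim (span_of v I))%N.
  apply: dimvS; apply/subv_sumP => i; rewrite inE => /sI iI.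
  exact: sumv_sup iI (subvv _).
rewrite dim_span_of //; last by rewrite cardsE (card_uniqP us) ss.
rewrite cardsE (card_uniqP us) ss => ge.
by rewrite (gtn_eqF (leq_trans kd ge)) (gtn_eqF (ltn_trans kd dI)).
Qed.

Definition covectors k n (v : 'I_n -> 'rV[R]_d) : {set {ffun 'I_n -> option bool}} :=
  [set s | `[< exists u, covector v u = s >] && (#|zeros s| == k)]%SET.

Lemma f_covectors n (v : 'I_n -> 'rV[R]_d) k : separated v -> (k < d)%N ->
  f_ k (zonotope v) = #|covectors k v|.
Proof.
move=> sv kd; rewrite /f_.
have -> : [set F | is_face (zonotope v) F /\ has_dim F k]%classic =
          [set face_of v s | s in [set` covectors k v]]%classic.
  apply/seteqP; split=> F /=.
    move=> [zF dF].
    have [x Fx] : exists x, F x.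
      have [x0 [W [_ e]]] := dF.
      have : affine_hull F x0 by rewrite e; exists 0; rewrite /= ?mem0v ?addr0.
      move=> [[|m] [a [y [yF a1 _]]]]; last by exists (y ord0).
      by move: a1; rewrite big_ord0 => /eqP; rewrite eq_sym oner_eq0.
    have [u Fu] := is_face_covector zF Fx.
    exists (covector v u) => //=; rewrite inE; apply/andP; split.
      by apply/asboolP; exists u.
    by move: dF; rewrite Fu => /has_dim_face_of/eqP; rewrite dim_span_of_eq.
  move=> [s]; rewrite /= inE => /andP[/asboolP[u <-] zk] <-.
  split; first exact: face_of_is_face.
  by apply/has_dim_face_of/eqP; rewrite dim_span_of_eq.
rewrite fset_set_image; last exact: finite_finset.
rewrite card_in_imfset /=.
  have -> : fset_set [set` covectors k v]%classic =
            seq_fset tt (enum (covectors k v)).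
    apply/fsetP => s; rewrite seq_fsetE mem_enum in_fset_set; last exact: finite_finset.
    by apply/idP/idP => [/set_mem|sv']; rewrite //= ; apply/mem_set.
  by rewrite size_seq_fset undup_id ?enum_uniq// -cardE.
move=> s t; rewrite !in_fset_set; try exact: finite_finset.
move=> /set_mem /= + /set_mem /=.
by rewrite !inE => /andP[/asboolP[u <-] _] /andP[/asboolP[u' <-] _] /face_of_inj.
Qed.

End FaceDimension.

(** * Counting covectors *)
Section CovectorCount.
Context {R : realType} {d : nat}.
Implicit Types (u w x : 'rV[R]_d) (n k : nat).

Lemma sign_of_perturb (a e : R) : `|e| < `|a| -> sign_of (a + e) = sign_of a.
Proof.
rewrite /sign_of; have [->|a0] := eqVneq a 0.
  by rewrite normr0 ltNge normr_ge0.
have [ap|an] := ltP 0 a.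
  rewrite (gtr0_norm ap) ltr_norml => /andP[ea _].
  have : 0 < a + e by rewrite -ltrBlDl sub0r.
  by move=> /[dup] /gt_eqF -> ->.
rewrite (ler0_norm an) ltr_norml opprK => /andP[_ ea].
have : a + e < 0 by rewrite -ltrBrDl sub0r.
by move=> /[dup] /lt_eqF -> /lt_gtF ->.
Qed.

Lemma sign_of_pmul (c a : R) : 0 < c -> sign_of (c * a) = sign_of a.
Proof. by move=> c0; rewrite /sign_of mulf_eq0 (gt_eqF c0) /= pmulr_rgt0. Qed.

(** The covector axiom of composition for oriented matroids: [u' = u + w / m]
with [m] exceeding every ratio [|w . v_i| / |u . v_i|], so that no nonzero sign
of [u] is changed.  Division by zero gives a ratio 0 where [u . v_i = 0]. *)
Lemma covector_comp n (v : 'I_n -> 'rV[R]_d) u w :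
  exists u', forall i, covector v u' i =
    if covector v u i is Some b then Some b else covector v w i.
Proof.
pose a i := `|dotprod w (v i)| / `|dotprod u (v i)|.
have a0 i : 0 <= a i by rewrite divr_ge0.
pose m := 1 + \sum_i a i.
have am i : a i < m.
  by rewrite /m (bigD1 i) //= addrCA ltrDl (lt_le_trans ltr01)// lerDl sumr_ge0.
have m0 : 0 < m by rewrite (lt_le_trans ltr01)// lerDl sumr_ge0.
exists (u + m^-1 *: w) => i; rewrite !ffunE dotprodDl dotprodZl.
rewrite {2}/sign_of; have [->|u0] := eqVneq.
  by rewrite add0r sign_of_pmul// invr_gt0.
rewrite sign_of_perturb; first by rewrite /sign_of (negbTE u0).
rewrite normrM gtr0_norm ?invr_gt0// mulrC ltr_pdivrMr//.
by rewrite mulrC -ltr_pdivrMr ?normr_gt0//; exact: am.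
Qed.

Lemma covector_None n (v : 'I_n -> 'rV[R]_d) u i :
  (covector v u i == None) = (dotprod u (v i) == 0).
Proof. by rewrite ffunE /sign_of; case: (dotprod u (v i) == 0). Qed.

(** Starting from [u = 0], compose successively with functionals that vanish on
[I] but not at a given generator outside [I]. *)
Lemma covector_zeros n (v : 'I_n -> 'rV[R]_d) (I : {set 'I_n}) :
  separated v -> (#|I| < d)%N -> exists u, zeros (covector v u) = I.
Proof.
move=> sv Id.
have [u uI] : exists u, forall i, if i \in I then covector v u i == None
    else (i \in enum 'I_n) ==> (covector v u i != None).
  elim: (enum 'I_n) => [|j s [u uI]].
    by exists 0 => i; rewrite covector_None dotprod0l eqxx; case: ifP.
  have [jI|jI] := boolP (j \in I).
    exists u => i; have := uI i; case: ifP => // iI; rewrite inE.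
    by case: (eqVneq i j) => [ij|//]; rewrite ij jI in iI.
  have [w wI wj] := sv I j Id jI; have [u' hu'] := covector_comp v u w.
  exists u' => i; have := uI i; rewrite hu'; case: ifP => iI.
    by move=> /eqP ->; rewrite covector_None wI.
  rewrite inE; case: (covector v u i) => [b|] //=; first by rewrite !implybT.
  rewrite implybF => /negbTE ->; rewrite orbF; apply/implyP => /eqP ->.
  by rewrite covector_None wj oner_eq0.
exists u; apply/setP => i; rewrite inE; have := uI i; case: ifP => // _.
by rewrite mem_enum => /negbTE.
Qed.

Definition drop_last n (s : {ffun 'I_n.+1 -> option bool}) :=
  [ffun i : 'I_n => s (lift ord_max i)].

Lemma covector_drop_last n (v : 'I_n.+1 -> 'rV[R]_d) u :
  covector (v \o lift ord_max) u = drop_last (covector v u).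
Proof. by apply/ffunP => i; rewrite !ffunE. Qed.

Lemma lift_ord_maxF n (j : 'I_n) : (lift ord_max j == ord_max) = false.
Proof. by rewrite eq_sym (negbTE (neq_lift _ _)). Qed.

Lemma ord_max_notin_lift n (I : {set 'I_n}) : ord_max \notin lift ord_max @: I.
Proof. by apply/imsetP => -[j _ /eqP]; rewrite (negbTE (neq_lift _ _)). Qed.

Lemma card_zeros_drop_last n (s : {ffun 'I_n.+1 -> option bool}) :
  #|zeros s| = (#|zeros (drop_last s)| + (s ord_max == None))%N.
Proof.
have -> : zeros s = lift ord_max @: zeros (drop_last s) :|:
     (if s ord_max == None then [set ord_max] else finset.set0).
  apply/setP => i; rewrite !inE; case: (unliftP ord_max i) => [j|] ->.
    rewrite (mem_imset _ _ lift_inj) !inE ffunE; case: ifP => _; rewrite inE ?orbF//.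
    by rewrite lift_ord_maxF orbF.
  rewrite (negbTE (ord_max_notin_lift _)) /=.
  by case: ifP; rewrite inE// eqxx.
rewrite cardsU disjoint_setI0; last first.
  rewrite disjoint_subset; apply/fintype.subsetP => _ /imsetP[j _ ->]; rewrite inE.
  by case: ifP; rewrite inE// lift_ord_maxF.
rewrite cards0 subn0 card_imset; last exact: lift_inj.
by case: (s ord_max == None); rewrite ?cards1 ?cards0.
Qed.

(** If [u] vanishes at the last generator, it is composed with a functional that
vanishes at the other zeros of [u] but not there. *)
Lemma covector_extend n (v : 'I_n.+1 -> 'rV[R]_d) u : separated v ->
  (#|zeros (covector (v \o lift ord_max) u)| < d)%N ->
  exists u', drop_last (covector v u') = covector (v \o lift ord_max) u /\
             covector v u' ord_max != None.
Proof.
move=> sv Zd; set I := zeros _ in Zd.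
have mI := ord_max_notin_lift I.
have [||w w0 w1] := sv (lift ord_max @: I) ord_max.
- by rewrite card_imset//; exact: lift_inj.
- exact: mI.
have [u' hu'] := covector_comp v u w; exists u'; split.
  apply/ffunP => i; rewrite covector_drop_last [LHS]ffunE hu' [RHS]ffunE.
  case e : (covector v u _) => [//|]; apply/eqP.
  rewrite covector_None w0// imset_f// inE.
  by rewrite covector_drop_last ffunE e.
rewrite hu'; case e : (covector v u _) => [//|].
by rewrite covector_None w1 oner_eq0.
Qed.

(** The sign pattern [t] is the surplus: all patterns on the first [n] generators
are restrictions of patterns other than [t]. *)
Lemma covectors_surplus n k (v : 'I_n.+1 -> 'rV[R]_d) : separated v ->
  (0 < n)%N -> (1 < d)%N -> (k < minn n d)%N ->
  exists2 t, t \in covectors k v &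
    covectors k (v \o lift ord_max) \subset @drop_last n @: (covectors k v :\ t).
Proof.
move=> sv n0 d1; rewrite leq_min => /andP[kn kd].
have ext s : s \in covectors k (v \o lift ord_max) ->
    exists t, [/\ t \in covectors k v, drop_last t = s & t ord_max != None].
  rewrite inE => /andP[/asboolP[u us] /eqP sk].
  have [|u' [u's u'm]] := @covector_extend n v u sv; first by rewrite us sk.
  exists (covector v u'); split=> //; last by rewrite u's us.
  rewrite inE; apply/andP; split; first by apply/asboolP; exists u'.
  by rewrite card_zeros_drop_last (negbTE u'm) u's us sk addn0.
(* For positive [k], the pattern [t] vanishes at the last generator and [k - 1]
   others, whereas the extensions of [ext] do not vanish there. *)
case: k => [|k] in kn kd ext *; last first.
  have /card_geqP[r [ur rk _]] : (k <= #|'I_n|)%N by rewrite card_ord ltnW// ltnW.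
  have cI : #|ord_max |: lift ord_max @: [set i in r]| = k.+1.
    rewrite cardsU1 card_imset; last exact: lift_inj.
    by rewrite cardsE (card_uniqP ur) rk ord_max_notin_lift.
  have [|u uI] := covector_zeros (I := ord_max |: lift ord_max @: [set i in r]) sv.
    by rewrite cI.
  exists (covector v u).
    by rewrite inE uI cI eqxx andbT; apply/asboolP; exists u.
  apply/fintype.subsetP => s /ext[t [tk <- tm]]; apply: imset_f; rewrite !inE in tk *.
  rewrite tk andbT; apply: contraNneq tm => ->.
  have : ord_max \in zeros (covector v u) by rewrite uI !inE eqxx.
  by rewrite inE.
(* For [k = 0], start from a functional that vanishes at the last generator only
   and move away from it in the directions [w] and [- w]; the two patterns
   obtained have the same restriction.  This needs [1 < d]. *)
have [|u uI] := covector_zeros (I := [set ord_max]) sv; first by rewrite cards1.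
have [||w _ w1] := sv finset.set0 ord_max; rewrite ?cards0 ?inE// 1?ltnW//.
have um : covector v u ord_max = None.
  have : ord_max \in zeros (covector v u) by rewrite uI inE.
  by rewrite inE => /eqP.
have ul j : covector v u (lift ord_max j) != None.
  have : lift ord_max j \notin zeros (covector v u).
    by rewrite uI inE lift_ord_maxF.
  by rewrite inE.
have sgn (c : R) : c != 0 -> exists t, [/\ t \in covectors 0 v,
    drop_last t = drop_last (covector v u) & t ord_max = sign_of c].
  move=> c0; have [u' hu'] := covector_comp v u (c *: w).
  have dl : drop_last (covector v u') = drop_last (covector v u).
    apply/ffunP => j; rewrite ffunE hu' [RHS]ffunE.
    by case: (covector v u _) (ul j).
  have u'm : covector v u' ord_max = sign_of c.
    by rewrite hu' um ffunE dotprodZl w1 mulr1.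
  exists (covector v u'); split=> //; rewrite inE; apply/andP; split.
    by apply/asboolP; exists u'.
  have := card_zeros_drop_last (covector v u); rewrite uI cards1 um eqxx addn1.
  move=> [z0]; rewrite card_zeros_drop_last dl -z0 u'm /sign_of.
  by rewrite (negbTE c0).
have [t [tk td tm]] := sgn 1 (oner_neq0 _).
have [|t' [t'k t'd t'm]] := sgn (- 1); first by rewrite oppr_eq0 oner_neq0.
have tt' : t' != t.
  apply: contra_eq_neq t'm => ->; rewrite tm /sign_of oppr_eq0 oner_eq0 ltr01.
  by rewrite oppr_gt0 ltr10.
exists t => //; apply/fintype.subsetP => s /ext[t0 [t0k <- _]].
have [->|t0t] := eqVneq t0 t.
  by rewrite td -t'd; apply: imset_f; rewrite in_setD1 tt'.
by apply: imset_f; rewrite in_setD1 t0t.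
Qed.

Lemma ltn_card_covectors n k (v : 'I_n.+1 -> 'rV[R]_d) : separated v ->
  (0 < n)%N -> (1 < d)%N -> (k < minn n d)%N ->
  (#|covectors k (v \o lift ord_max)| < #|covectors k v|)%N.
Proof.
move=> sv n0 d1 kl; have [t tk sub] := covectors_surplus sv n0 d1 kl.
rewrite [ltnRHS](cardsD1 t) tk ltnS.
exact: leq_trans (subset_leq_card sub) (leq_imset_card _ _).
Qed.

Lemma leq_card_covectors n k (v : 'I_n -> 'rV[R]_d) : (#|covectors k v| <= 3 ^ n)%N.
Proof.
apply: leq_trans (max_card _) _.
by rewrite card_ffun card_ord card_option card_bool.
Qed.

End CovectorCount.

(** * General position *)
Section GeneralPosition.
Context {R : realType} {d : nat}.

(** The indices range over all natural numbers rather than over the first [n],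
so that fewer than [d] generators can be completed to a square matrix. *)
Definition general_position (v : nat -> 'rV[R]_d) :=
  forall J : 'I_d -> nat, injective J -> \matrix_(i < d) v (J i) \in unitmx.

(** Complete [j] and [I] to [d] distinct indices; the functional is the column of
the inverse matrix that belongs to [j]. *)
Lemma general_position_separated (v : nat -> 'rV[R]_d) n :
  general_position v -> separated (fun i : 'I_n => v i).
Proof.
move=> gv I j Id jI.
pose l := ([seq val i | i <- j :: enum I] ++ iota n d)%SEQ.
have ul : uniq l.
  rewrite cat_uniq map_inj_uniq ?iota_uniq ?andbT; last exact: val_inj.
  rewrite cons_uniq mem_enum jI enum_uniq /=; apply/hasPn => m.
  rewrite mem_iota => /andP[nm _]; apply/negP => /(@mapP _ _ val (j :: enum I))[i _ mi].
  by rewrite mi leqNgt ltn_ord in nm.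
have d0 : (0 < d)%N by exact: leq_ltn_trans Id.
have ld : (d <= size l)%N by rewrite size_cat size_iota leq_addl.
pose J (i : 'I_d) := nth 0%N l i.
have Jinj : injective J.
  move=> a b /eqP; rewrite nth_uniq// ?(leq_trans (ltn_ord _) ld)// => /eqP.
  exact: val_inj.
have := gv J Jinj; set M := \matrix_(i < d) _ => Mu.
pose w := (invmx M *m delta_mx (Ordinal d0) (0 : 'I_1))^T.
have wJ i : dotprod w (v (J i)) = (i == Ordinal d0)%:R.
  transitivity ((M *m w^T) i 0).
    by rewrite mxE; apply: eq_bigr => c _; rewrite !mxE mulrC.
  by rewrite trmxK mulmxA mulmxV// mul1mx mxE eqxx andbT.
exists w; last by have := wJ (Ordinal d0); rewrite eqxx.
move=> i iI; have iE : (index i (enum I) < size (enum I))%N by rewrite index_mem mem_enum.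
have iI' : ((index i (enum I)).+1 < d)%N by apply: leq_ltn_trans Id; rewrite cardE.
have := wJ (Ordinal iI'); rewrite /J /= nth_cat size_map iE.
by rewrite (nth_map i)// nth_index ?mem_enum.
Qed.

End GeneralPosition.

(** * Comparing expectations on an event of probability one *)
Section Expectation.
Context {R : realType} {disp : measure_display} {Omega : measurableType disp}.
Variable P : probability Omega R.
Local Open Scope ereal_scope.
Local Open Scope classical_set_scope.
Import HBNNSimple.

Lemma sintegral_full_measure (D : set Omega) (h : {nnsfun Omega >-> R}) :
  measurable D -> P D = 1 -> sintegral P h = \int[P]_(w in D) (h w)%:E.
Proof.
move=> mD PD; rewrite -integralT_nnsfun.
have PD0 : P (~` D) = 0 by rewrite probability_setC// PD subee.
rewrite (@ge0_negligible_integral _ _ _ _ setT (~` D)) ?setTD ?setCK//.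
- exact: measurableC.
- by apply/measurable_EFinP.
- by move=> w _; rewrite lee_fin.
Qed.

(** So that no measurability of face numbers has to be established, the comparison
goes through the integral as a supremum over simple functions: a simple
[h <= f] gives the simple function [(h + 1) 1_D <= g], whose integral is larger
by 1. *)
Lemma expectation_lt_full_measure (f g : Omega -> R) (D : set Omega) (C : R) :
  measurable D -> P D = 1 ->
  (forall w, 0 <= f w)%R -> (forall w, 0 <= g w)%R ->
  (forall w, D w -> f w <= C)%R -> (forall w, D w -> f w + 1 <= g w)%R ->
  'E_P[f] < 'E_P[g].
Proof.
move=> mD PD f0 g0 fC fg; rewrite unlock.
have key (h : {nnsfun Omega >-> R}) : (forall w, h w <= f w)%R ->
    sintegral P h <= C%:E /\ sintegral P h + 1 <= \int[P]_w (g w)%:E.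
  move=> hf; have mh : measurable_fun D (EFin \o h).
    by apply/measurable_EFinP; apply: measurable_funS (measurable_funPT h).
  split.
    rewrite (sintegral_full_measure h mD PD).
    rewrite -[leRHS]mule1 -PD -integral_cst//.
    apply: ge0_le_integral => //.
    - by move=> w _; rewrite lee_fin.
    - by move=> w Dw; rewrite lee_fin (le_trans (hf w)) ?fC.
  pose q := proj_nnsfun (add_nnsfun h (cst_nnsfun Omega (NngNum (@ler01 R)))) mD.
  have -> : sintegral P h + 1 = sintegral P q.
    rewrite (sintegral_full_measure h mD PD) (sintegral_full_measure q mD PD).
    rewrite -{1}PD -[P D]mul1e -integral_cst// -ge0_integralD//.
    - apply: eq_integral => w wD; rewrite /q /= /mindic indicE wD.
      by rewrite -EFinD mulr1.
    - by move=> w _; rewrite lee_fin.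
  rewrite ge0_integralTE; last by move=> w; rewrite lee_fin.
  apply: ereal_sup_ubound; exists q => // w; rewrite lee_fin /q /= /mindic indicE.
  have [/set_mem Dw|_] := boolP (w \in D); last by rewrite mulr0.
  by rewrite mulr1 (le_trans _ (fg w Dw))// lerD2r.
have fC' : \int[P]_w (f w)%:E <= C%:E.
  rewrite ge0_integralTE; last by move=> w; rewrite lee_fin.
  by apply: ub_ereal_sup => _ [h hf <-]; have [] := key h hf.
have ffin : \int[P]_w (f w)%:E \is a fin_num.
  rewrite ge0_fin_numE ?(le_lt_trans fC') ?ltry//.
  by apply: integral_ge0 => w _; rewrite lee_fin.
suff : \int[P]_w (f w)%:E + 1 <= \int[P]_w (g w)%:E.
  by apply: lt_le_trans; rewrite lteDl// lte01.
rewrite -leeBrDr//.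
rewrite [leLHS]ge0_integralTE; last by move=> w; rewrite lee_fin.
apply: ub_ereal_sup => _ [h hf <-]; rewrite leeBrDr//.
by have [] := key h hf.
Qed.

End Expectation.

(** * An affine equation in an independent atomless variable *)
Section AffineRoot.
Context {R : realType} {disp : measure_display} {Omega : measurableType disp}.
Variable P : probability Omega R.
Local Open Scope ereal_scope.
Local Open Scope classical_set_scope.

Lemma normal_prob_set1 (y : R) : normal_prob (0 : R)%R 1%R [set y] = 0.
Proof.
have /null_content_dominatesP := @normal_prob_dominates R 0%R 1%R.
by apply; [exact: measurable_set1 | exact: lebesgue_measure_set1].
Qed.

(** The joint law of [(U, Y)] is the product of the laws of [U] and [Y], and the
section over [x] of the set in question contains at most the point
[- B x / A x]. *)
Lemma affine_root_null (d1 : measure_display) (T1 : measurableType d1)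
    (U : {mfun Omega >-> T1}) (Y : {RV P >-> R})
    (A B : T1 -> R) :
  measurable_fun setT A -> measurable_fun setT B ->
  (forall y, P (Y @^-1` [set y]) = 0) ->
  (forall E S, measurable E -> measurable S ->
    P (U @^-1` E `&` Y @^-1` S) = P (U @^-1` E) * P (Y @^-1` S)) ->
  P.-negligible [set w | (A (U w) != 0)%R && (A (U w) * Y w + B (U w) == 0)%R].
Proof.
move=> mA mB Y0 ind.
pose D := [set z : T1 * R | (A z.1 != 0)%R && (A z.1 * z.2 + B z.1 == 0)%R].
have mD : measurable D.
  rewrite -[D]setTI.
  have := @measurable_and _ (T1 * R)%type setT
    (fun z => ~~ (A z.1 == 0)%R) (fun z => (A z.1 * z.2 + B z.1 == 0)%R).
  have mA1 : measurable_fun setT (fun z : T1 * R => A z.1).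
    exact: measurableT_comp mA measurable_fst.
  have mB1 : measurable_fun setT (fun z : T1 * R => B z.1).
    exact: measurableT_comp mB measurable_fst.
  move=> /(_ _ _ measurableT [set true] I); apply.
  - by apply: measurable_neg; exact: measurable_fun_eqr.
  - apply: measurable_fun_eqr => //; apply: measurable_funD => //.
    by apply: measurable_funM => //; exact: measurable_snd.
have mUY : measurable_fun setT (fun w => (U w, Y w) : T1 * R).
  by apply: measurable_fun_pair; exact: measurable_funPT.
pose UY : {mfun Omega >-> (T1 * R)%type} := mfun_Sub (mem_set mUY).
exists (UY @^-1` D); split=> //.
  by have := measurable_funPT UY measurableT D mD; rewrite setTI.
change (distribution P UY D = 0).
have <- := @product_measure_unique _ _ _ _ R (distribution P U)
  (distribution P Y)  (distribution P UY) ind D mD.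
rewrite /= /product_measure1; apply: integral0_eq => x _ /=.
have [Ax0|Ax0] := eqVneq (A x) 0%R.
  rewrite (_ : xsection D x = set0) ?measure0//.
  by apply/seteqP; split=> y //; rewrite /xsection /= inE /D /= Ax0 eqxx.
rewrite (_ : xsection D x = [set - B x / A x]%R) ?[LHS]Y0//.
apply/seteqP; split=> y; rewrite /xsection /= inE /D /= Ax0 /=.
  by rewrite addr_eq0 => /eqP <-; rewrite mulrC mulKf.
by move=> ->; rewrite mulrC divfK// addNr.
Qed.

End AffineRoot.

(** * Independence of the coordinates of Gaussian vectors *)
Section GaussianCoordinates.
Context {R : realType} {disp : measure_display} {Omega : measurableType disp}.
Variables (P : probability Omega R) (d : nat).
Variable X : nat -> {RV P >-> borel_rV R d}.
Hypothesis Xindep : independent_RVs X.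
Hypothesis Xgauss : forall i, standard_gaussian (X i).
Local Open Scope ereal_scope.
Local Open Scope classical_set_scope.

Definition coordinate (i : nat) (c : 'I_d) (w : Omega) : R :=
  (X i w : 'rV[R]_d) ord0 c.

Lemma measurable_entry (c : 'I_d) :
  measurable_fun setT (fun x : borel_rV R d => (x : 'rV[R]_d) ord0 c : R).
Proof.
apply: (measurability _ (RGenOpens.measurableE R)).
move=> _ [_ [a [b ->] <-]]; rewrite setTI; apply: sub_sigma_algebra.
have oU : open (`]a, b[ : set R) by exact: interval_open.
apply: open_comp oU => x _; exact: coord_continuous.
Qed.

Lemma measurable_coordinate i c : measurable_fun setT (coordinate i c).
Proof. exact: measurableT_comp (measurable_entry c) (measurable_funPT (X i)). Qed.

Lemma measurable_rectangle (A : 'I_d -> set R) : (forall c, measurable (A c)) ->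
  measurable ([set x | forall c, A c ((x : 'rV[R]_d) ord0 c)] : set (borel_rV R d)).
Proof.
move=> mA.
rewrite (_ : [set x | _] = \bigcap_(c in [set: 'I_d])
  ((fun x : borel_rV R d => (x : 'rV[R]_d) ord0 c : R) @^-1` A c)); last first.
  by apply/seteqP; split=> x /= h c //; [move=> _; exact: h | exact: h].
apply: fin_bigcap_measurable => [|c _]; first exact: finite_finset.
by rewrite -[X in measurable X]setTI; apply: measurable_entry.
Qed.

(** A coordinate is left free by giving it the set [setT], so a single shape of
event covers every finite set of coordinates. *)
Definition box (N : nat) (B : nat -> 'I_d -> set R) : set Omega :=
  [set w | forall i c, (i < N)%N -> B i c (coordinate i c w)].

Lemma measurable_box N B : (forall i c, measurable (B i c)) -> measurable (box N B).
Proof.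
move=> mB.
rewrite (_ : box N B = \bigcap_(i in `I_N) \bigcap_(c in [set: 'I_d])
  (coordinate i c @^-1` B i c)); last first.
  by apply/seteqP; split=> w /= h i; [move=> iN c _; exact: h | move=> c iN; exact: h].
apply: fin_bigcap_measurable => [|i _]; first exact: finite_II.
apply: fin_bigcap_measurable => [|c _]; first exact: finite_finset.
by rewrite -[X in measurable X]setTI; apply: measurable_coordinate.
Qed.

(** Independence of the vectors gives the outer product, independence of the
coordinates of each one the inner product. *)
Lemma probability_box N B : (forall i c, measurable (B i c)) ->
  P (box N B) = \prod_(i < N) \prod_(c < d) normal_prob 0%R 1%R (B i c).
Proof.
move=> mB.
pose S i : set (borel_rV R d) := [set x | forall c, B i c ((x : 'rV[R]_d) ord0 c)].
have -> : box N B = \bigcap_(i in [set` [fset i in iota 0 N]%fset]) (X i @^-1` S i).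
  apply/seteqP; split=> w /= h i.
    by rewrite /= inE mem_iota add0n => /andP[_ iN] c; exact: h.
  by move=> c iN; apply: (h i); rewrite /= inE mem_iota.
rewrite Xindep => [|i _]; last exact: measurable_rectangle.
rewrite -(big_mkord xpredT (fun i => \prod_(c < d) normal_prob 0%R 1%R (B i c))).
rewrite /index_iota subn0.
have -> : \prod_(i <- [fset i in iota 0 N]%fset) P (X i @^-1` S i) =
          \prod_(i <- iota 0 N) P (X i @^-1` S i).
  apply: perm_big; apply: uniq_perm; rewrite ?fset_uniq ?iota_uniq// => i.
  by rewrite inE.
by apply: eq_bigr => i _; exact: (Xgauss i (mB i)).
Qed.

Lemma normal_prob_setT : normal_prob (0 : R)%R 1%R setT = 1.
Proof. by rewrite /normal_prob integral_normal_pdf. Qed.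

Definition update (B : nat -> 'I_d -> set R) i0 c0 S : nat -> 'I_d -> set R :=
  fun i c => if (i == i0) && (c == c0) then S else B i c.

Lemma probability_box_update N B i0 c0 S : (i0 < N)%N ->
  (forall i c, measurable (B i c)) -> measurable S -> B i0 c0 = setT ->
  P (box N (update B i0 c0 S)) = P (box N B) * normal_prob 0%R 1%R S.
Proof.
move=> i0N mB mS B0; rewrite !probability_box//; last first.
  by move=> i c; rewrite /update; case: ifP.
rewrite (bigD1 (Ordinal i0N)) //= (bigD1 c0) //= {1}/update !eqxx /=.
rewrite [in RHS](bigD1 (Ordinal i0N)) //= [in RHS](bigD1 c0) //= B0.
rewrite normal_prob_setT mul1e -muleA muleC; congr (_ * _ * _).
  by apply: eq_bigr => c /negbTE cc; rewrite /update cc andbF.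
apply: eq_bigr => i /negbTE ii; apply: eq_bigr => c _; rewrite /update.
by move: ii; rewrite -val_eqE /= => ->.
Qed.

Lemma coordinate_law i c S : measurable S ->
  P (coordinate i c @^-1` S) = normal_prob 0%R 1%R S.
Proof.
move=> mS.
have -> : coordinate i c @^-1` S = box i.+1 (update (fun _ _ => setT) i c S).
  apply/seteqP; split=> w /= h.
    by move=> j e _; rewrite /update; case: ifP => // /andP[/eqP -> /eqP ->].
  by have := h i c (ltnSn i); rewrite /update !eqxx.
rewrite probability_box_update// (_ : box _ _ = setT) ?probability_setT ?mul1e//.
by apply/seteqP; split.
Qed.

(** The boxes that leave the coordinate [(i0, c0)] free.  They form a pi-system
that generates the sigma-algebra of the remaining coordinates of the first [N]
vectors. *)
Definition other_boxes N i0 c0 : set (set Omega) :=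
  [set E | exists B, [/\ forall i c, measurable (B i c), B i0 c0 = setT
                       & E = box N B]].

Lemma other_boxes_measurable N i0 c0 : other_boxes N i0 c0 `<=` measurable.
Proof. by move=> _ [B [mB _ ->]]; exact: measurable_box. Qed.

Lemma other_boxes_setI N i0 c0 : setI_closed (other_boxes N i0 c0).
Proof.
move=> _ _ [B [mB B0 ->]] [B' [mB' B'0 ->]].
exists (fun i c => B i c `&` B' i c); split.
- by move=> i c; apply: measurableI.
- by rewrite B0 B'0 setIT.
- apply/seteqP; split=> w /= h.
    by move=> i c iN; split; [apply: h.1|apply: h.2].
  by split=> i c iN; case: (h i c iN).
Qed.

Lemma other_boxes_setT N i0 c0 : other_boxes N i0 c0 setT.
Proof. by exists (fun _ _ => setT); split=> //; apply/seteqP; split. Qed.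

(** As functions of [E], both sides are finite measures that agree on the
pi-system of boxes, hence on the generated sigma-algebra. *)
Lemma coordinate_indep N i0 c0 E S : (i0 < N)%N ->
  <<s other_boxes N i0 c0 >> E -> measurable S ->
  P (E `&` coordinate i0 c0 @^-1` S) = P E * P (coordinate i0 c0 @^-1` S).
Proof.
move=> i0N sE mS.
have mY : measurable (coordinate i0 c0 @^-1` S).
  by rewrite -[X in measurable X]setTI; apply: measurable_coordinate.
have p0 : (0 <= fine (P (coordinate i0 c0 @^-1` S)))%R by apply: fine_ge0.
have pE : (NngNum p0)%:num%:E = P (coordinate i0 c0 @^-1` S).
  by rewrite /= fineK ?fin_num_measure.
suff : mrestr P mY E = mscale (NngNum p0) P E.
  by move=> e; rewrite -pE muleC; exact: e.
apply: (@g_sigma_algebra_measure_unique _ _ _ (other_boxes N i0 c0) _ (fun=> setT)).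
- exact: other_boxes_measurable.
- by move=> _; exact: other_boxes_setT.
- by rewrite bigcup_const//; exists 0%N.
- exact: other_boxes_setI.
- move=> _ [B [mB B0 ->]].
  change (P (box N B `&` coordinate i0 c0 @^-1` S) = (NngNum p0)%:num%:E * P (box N B)).
  rewrite pE.
  rewrite (_ : box N B `&` _ = box N (update B i0 c0 S)).
    rewrite probability_box_update// -(coordinate_law i0 c0)//.
    by rewrite muleC.
  apply/seteqP; split=> w /=.
    move=> [h hS] i c iN; rewrite /update; case: ifP => [/andP[/eqP -> /eqP ->]//|_].
    exact: h.
  move=> h; split; last by have := h i0 c0 i0N; rewrite /update !eqxx.
  move=> i c iN; have := h i c iN; rewrite /update.
  by case: ifP => // /andP[/eqP -> /eqP ->]; rewrite B0.
- move=> _; change (P (setT `&` coordinate i0 c0 @^-1` S) < +oo).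
  by rewrite setTI (le_lt_trans (probability_le1 _ _))// ltry.
- exact: sE.
Qed.

Lemma measurable_coordinate_other N i0 c0 i c : (i < N)%N ->
  (i, c) != (i0, c0) ->
  measurable_fun setT
    (coordinate i c : g_sigma_algebraType (other_boxes N i0 c0) -> R).
Proof.
move=> iN ic _ S mS; rewrite setTI; apply: sub_sigma_algebra.
exists (update (fun _ _ => setT) i c S); split.
- by move=> j e; rewrite /update; case: ifP.
- by rewrite /update -xpair_eqE eq_sym (negbTE ic).
- apply/seteqP; split=> w /= h.
    by move=> j e _; rewrite /update; case: ifP => // /andP[/eqP -> /eqP ->].
  by have := h i c iN; rewrite /update !eqxx.
Qed.

Lemma measurable_det (d1 : measure_display) (T1 : measurableType d1) n
    (M : T1 -> 'M[R]_n) :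
  (forall i j, measurable_fun setT (fun w => M w i j)) ->
  measurable_fun setT (fun w => \det (M w)).
Proof.
move=> mM; rewrite /determinant; apply: measurable_sum => s.
apply: measurable_funM => //; apply: measurable_prod => i _; exact: mM.
Qed.

(** * Almost sure general position *)
Variable J : 'I_d -> nat.
Hypothesis J_inj : injective J.

(** Interpolates between the identity matrix ([m = 0]) and the matrix of the
chosen random vectors ([m = d]). *)
Definition partial_matrix m (w : Omega) : 'M[R]_d :=
  \matrix_(a < d, b < d) if (a < m)%N then coordinate (J a) b w else (a == b)%:R.

(** Expansion by linearity in row [i]: the diagonal entry is split off from the
other entries of that row. *)
Lemma det_partial_matrix_step (i : 'I_d) w :
  \det (partial_matrix i.+1 w) =
  (\det (partial_matrix i w) * coordinate (J i) i w +
   \det (\matrix_(a < d, b < d)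
     if (a == i) && (b == i) then 0 else partial_matrix i.+1 w a b))%R.
Proof.
rewrite mulrC -[X in (_ + X)%R]mul1r; apply: (determinant_multilinear (i0 := i)).
- apply/rowP => b; rewrite !mxE ltnn ltnS leqnn eqxx /= [i == b]eq_sym.
  case: eqVneq => [->|_]; first by rewrite mulr1 mulr0 addr0.
  by rewrite mulr0 add0r mul1r.
- apply/matrixP => a b; rewrite !mxE ltnS [in RHS]leq_eqVlt.
  suff -> : (lift i a == i :> nat) = false by [].
  by apply/negbTE; change (lift i a != i); rewrite eq_sym neq_lift.
- by apply/matrixP => a b; rewrite !mxE eq_sym (negbTE (neq_lift _ _)).
Qed.

Lemma det_partial_matrix_null m : (m <= d)%N ->
  P.-negligible [set w | \det (partial_matrix m w) = 0%R].
Proof.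
elim: m => [_|m IH md].
  rewrite (_ : [set _ | _] = set0); first exact: negligible_set0.
  apply/seteqP; split=> w //=; rewrite (_ : partial_matrix 0 w = 1%:M)%R.
    by rewrite det1 => /eqP; rewrite oner_eq0.
  by apply/matrixP => a b; rewrite !mxE.
(* [Y] is the diagonal entry that the new row brings in; [A] and [B] do not
   involve it, hence are measurable for the sigma-algebra of the other
   coordinates. *)
pose i := Ordinal md; pose N := (\max_(a < d) J a).+1.
have JN a : (J a < N)%N by rewrite ltnS (leq_bigmax a).
pose G := other_boxes N (J i) i.
have mU : measurable_fun setT (id : Omega -> g_sigma_algebraType G).
  move=> _ E sE; rewrite setTI preimage_id.
  by apply: (smallest_sub _ _ sE); [exact: sigma_algebra_measurable|exact: other_boxes_measurable].
pose U : {mfun Omega >-> g_sigma_algebraType G} := mfun_Sub (mem_set mU).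
pose Y : {RV P >-> R} := mfun_Sub (mem_set (measurable_coordinate (J i) i)).
pose A : g_sigma_algebraType G -> R := fun w => \det (partial_matrix i w).
pose B : g_sigma_algebraType G -> R := fun w => \det (\matrix_(a < d, b < d)
     if (a == i) && (b == i) then 0%R else partial_matrix i.+1 w a b).
have null : P.-negligible
    [set w | (A (U w) != 0)%R && (A (U w) * Y w + B (U w) == 0)%R].
  apply: affine_root_null.
  - apply: measurable_det => a b; rewrite (_ : (fun w => _) = fun w =>
        if (a < i)%N then coordinate (J a) b w else (a == b)%:R); last first.
      by apply/funext => w; rewrite mxE.
    have [am|_] := boolP (a < i)%N; last exact: measurable_cst.
    apply: measurable_coordinate_other => //.
    rewrite xpair_eqE negb_and; apply/orP; left.
    by rewrite (inj_eq J_inj) neq_ltn am.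
  - apply: measurable_det => a b; rewrite (_ : (fun w => _) = fun w =>
        if (a == i) && (b == i) then 0%R
        else if (a < i.+1)%N then coordinate (J a) b w else (a == b)%:R); last first.
      by apply/funext => w; rewrite !mxE.
    have [_|ab] := boolP ((a == i) && (b == i)); first exact: measurable_cst.
    have [am|_] := boolP (a < i.+1)%N; last exact: measurable_cst.
    by apply: measurable_coordinate_other => //; rewrite xpair_eqE (inj_eq J_inj).
  - by move=> y; rewrite (coordinate_law _ _ (measurable_set1 y)) normal_prob_set1.
  - by move=> E S sE mS; apply: (coordinate_indep _ sE mS).
apply: (@negligibleS _ _ _ _ ([set w | \det (partial_matrix m w) = 0%R] `|`
  [set w | (A (U w) != 0)%R && (A (U w) * Y w + B (U w) == 0)%R])).
  move=> w /=; rewrite (det_partial_matrix_step i) => e.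
  have [A0|A0] := eqVneq (\det (partial_matrix m w)) 0%R; [by left|right].
  by apply/andP; split=> //; apply/eqP; exact: e.
apply: negligibleU; first exact: IH (ltnW md).
exact: null.
Qed.

End GaussianCoordinates.

(** There are countably many choices of [d] indices, and each determinant vanishes
on a null set only. *)
Lemma general_position_ae (R : realType) (disp : measure_display)
    (Omega : measurableType disp) (P : probability Omega R) (d : nat)
    (X : nat -> {RV P >-> borel_rV R d}) :
  independent_RVs X -> (forall i, standard_gaussian (X i)) ->
  P.-negligible [set w | ~ general_position (fun i => X i w : 'rV[R]_d)]%classic.
Proof.
move=> Xindep Xgauss.
pose F (k : nat) : set Omega := [set w | exists2 J : {ffun 'I_d -> nat},
  choice.unpickle k = Some J /\ injective J & \det (partial_matrix X J d w) = 0]%classic.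
apply: (@negligibleS _ _ _ _ (\bigcup_k F k)%classic).
  move=> w /= /existsNP[J /not_implyP[Jinj Ju]].
  exists (choice.pickle (finfun J)) => //; exists (finfun J).
    by rewrite choice.pickleK; split=> // a b; rewrite !ffunE => /Jinj.
  apply/eqP; apply/negPn/negP; rewrite -unitfE -unitmxE => u; apply: Ju.
  rewrite (_ : \matrix_(i < d) _ = partial_matrix X (finfun J) d w)//.
  by apply/matrixP => a b; rewrite !mxE ltn_ord ffunE.
apply: negligible_bigcup => k.
case e: (choice.unpickle k : option {ffun 'I_d -> nat}) => [J|]; last first.
  apply: (negligibleS _ (negligible_set0 P)) => w /= [J []].
  by rewrite e.
have [Jinj|Jinj] := pselect (injective J); last first.
  apply: (negligibleS _ (negligible_set0 P)) => w /= [J' []].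
  by rewrite e => -[<-].
apply: (negligibleS _ (det_partial_matrix_null Xindep Xgauss Jinj (leqnn d))).
by move=> w /= [J' []]; rewrite e => -[<-].
Qed.

Unset Implicit Arguments.

Theorem theorem4p3 (R : realType) (disp : measure_display)
  (Omega : measurableType disp) (P : probability Omega R) (d : nat)
  (X : nat -> {RV P >-> borel_rV R d})
  (Xindep : independent_RVs X)
  (Xgauss : forall i, standard_gaussian (X i))
  (n k : nat) (n_ge1 : (1 <= n)%N) (d_ge2 : (2 <= d)%N)
  (k_lt : (k < minn n d)%N) :
  ('E_P[fun w => (f_ k (gaussian_zonotope X n w))%:R : R]
  < 'E_P[fun w => (f_ k (gaussian_zonotope X n.+1 w))%:R : R])%E.
Proof.
have [N [mN PN0 sN]] := general_position_ae Xindep Xgauss.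
have kd : (k < d)%N by move: k_lt; rewrite leq_min => /andP[].
have gp w : (~` N)%classic w -> general_position (fun i => X i w : 'rV[R]_d).
  by move=> nN; apply: contrapT => /sN.
apply: (@expectation_lt_full_measure _ _ _ P _ _ (~` N)%classic (3 ^ n)%:R).
- exact: measurableC.
- by rewrite probability_setC// PN0 sube0.
- by move=> w.
- by move=> w.
- move=> w /gp/(@general_position_separated _ _ _ n) sw.
  by rewrite ler_nat (f_covectors sw kd) leq_card_covectors.
- move=> w /gp gw.
  have sn := general_position_separated (n := n) gw.
  have sn1 := general_position_separated (n := n.+1) gw.
  rewrite natr1 ler_nat (f_covectors sn kd) (f_covectors sn1 kd).
  have := ltn_card_covectors sn1 n_ge1 d_ge2 k_lt.
  rewrite (_ : _ \o lift ord_max = fun i : 'I_n => X i w)//.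
  by apply/funext => i; rewrite /= /bump leqNgt ltn_ord.
Qed.
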